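(* Let $\kappa,e_1,\dots,e_9\in\mathbb{C}^\times$ with $e_i$ pairwise distinct and $\kappa^3\prod_{i=1}^9e_i=1$, and let $A(x)=I+A^{(1)}x+A^{(2)}x^2+\kappa Ix^3$ be a $3\times3$ matrix polynomial with $\det A(x)=\kappa^3\prod_{i=1}^9(x+e_i)$. Define constant $3\times3$ matrices $A_1,A_2,A_3$ by $$\sum_{i=1}^3\frac{A_i}{x+e_i}=\frac{I-A'(x)}{(1-q)x},\qquad A'(x)=\frac{A(x)}{(1+x/e_1)(1+x/e_2)(1+x/e_3)}.$$ Assume $\kappa e_1e_2e_3\neq1$ and $\mathrm{Ker}A_1\cap\mathrm{Ker}A_2\cap\mathrm{Ker}A_3=\{0\}$. Put $q^\lambda=(\kappa e_1e_2e_3)^{-1}$ and apply the $q$-middle convolution $mc_\lambda$ to $(A_1,A_2,A_3)$ with points $(t_1,t_2,t_3)=(-e_1,-e_2,-e_3)$. Then the quotient space $\mathbb{C}^9/(\mathcal K+\mathcal L)$ is $3$-dimensional, and, writing $\bar G_1,\bar G_2,\bar G_3$ for the induced $3\times3$ matrices in any basis, the matrix $$\tilde A(x)=(1+x/e_1)(1+x/e_2)(1+x/e_3)\Big[I-(1-q)x\sum_{i=1}^3\frac{\bar G_i}{x+e_i}\Big]$$ is a polynomial of the form $\tilde A(x)=I+\tilde A^{(1)}x+\tilde A^{(2)}x^2+\tilde\kappa Ix^3$ with $\det\tilde A(x)=\tilde\kappa^3\prod_{i=1}^9(x+\tilde e_i)$, where $\tilde e_i=e_i$ for $i=1,2,3$,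 $\tilde e_i=\kappa e_1e_2e_3e_i$ for $i=4,\dots,9$, and $\tilde\kappa=\frac{1}{\kappa(e_1e_2e_3)^2}$.
   Context: Fix $q$ with $0<|q|<1$, $[\lambda]=\frac{1-q^\lambda}{1-q}$ (only the value $q^\lambda$ matters). The system $T_xy=A(x)y$, after the gauge transformation by $g=(-x/e_1)_\infty(-x/e_2)_\infty(-x/e_3)_\infty$, becomes $T_xy=A'y$, equivalently $D_xy=\sum_i\frac{A_i}{x+e_i}y$; the matrix $\tilde A$ corresponds to applying $mc_\lambda$ and then the gauge transformation by $g^{-1}$. $q$-middle convolution: given constant $M\times M$ matrices $B_1,\dots,B_N$ (attached to the system $D_xy=\sum_i\frac{B_i}{x-t_i}y$) and $\lambda$, let $G_i$ ($MN\times MN$) have $i$-th block row $[q^\lambda B_1,\dots,q^\lambda B_{i-1},q^\lambda B_i+[\lambda]I_M,q^\lambda B_{i+1},\dots,q^\lambda B_N]$ and zero other block rows. Let $\mathcal K=\mathrm{Ker}B_1\oplus\cdots\oplus\mathrm{Ker}B_N\subset\mathbb{C}^{MN}$ and $\mathcal L=\mathrm{Ker}(G_1+\cdots+G_N)$; both are invariant under every $G_i$. $mc_\lambda(B_1,\dots,B_N)=(\bar G_1,\dots,\bar G_N)$, where $\bar G_i$ is the endomorphism induced by $G_i$ on $\mathbb{C}^{MN}/(\mathcal K+\mathcal L)$. *)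

(* Defs.v *)
From HB Require Import structures.
From mathcomp Require Import all_boot all_order all_algebra.
From mathcomp Require Import mxtens complex.
From mathcomp Require Import reals.
Set Implicit Arguments. Unset Strict Implicit. Unset Printing Implicit Defensive.
Import Order.TTheory GRing.Theory Num.Theory.
Local Open Scope ring_scope.

Section QMiddleConvolution.
Variable F : fieldType.
Variables N M : nat.

(* Vectors of F^{MN} are column vectors 'cV_(N*M), split into N blocks of size
   M: the index a : 'I_(N*M) corresponds to (block i, coordinate r) =
   mxtens_unindex a, i.e. a = i*M + r. *)

(* G_k : the k-th block row is
   [q^l B_1, ..., q^l B_{k-1}, q^l B_k + [l] I_M, q^l B_{k+1}, ..., q^l B_N],
   all other block rows are zero.  ql stands for q^lambda, lb for [lambda]. *)
Definition qmc_G (B : 'I_N -> 'M[F]_M) (ql lb : F) (k : 'I_N) : 'M[F]_(N * M) :=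
  \matrix_(a, b)
    let: (i, r) := mxtens_unindex a in
    let: (j, s) := mxtens_unindex b in
    if i == k then ql * B j r s + ((j == k) && (r == s))%:R * lb else 0.

(* Subspaces of column vectors are represented (mxalgebra, row-space
   convention) by matrices whose row space is {v^T | v in the subspace}. *)

(* K = Ker B_1 (+) ... (+) Ker B_N : block-diagonal matrix whose i-th diagonal
   block is kermx (B_i^T), whose row space is {w | B_i w^T = 0}. *)
Definition qmc_K (B : 'I_N -> 'M[F]_M) : 'M[F]_(N * M) :=
  \matrix_(a, b)
    let: (i, r) := mxtens_unindex a in
    let: (j, s) := mxtens_unindex b in
    if i == j then kermx (B i)^T r s else 0.

Definition qmc_L (B : 'I_N -> 'M[F]_M) (ql lb : F) : 'M[F]_(N * M) :=
  kermx (\sum_k qmc_G B ql lb k)^T.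

Definition qmc_KL (B : 'I_N -> 'M[F]_M) (ql lb : F) : 'M[F]_(N * M) :=
  (qmc_K B + qmc_L B ql lb)%MS.

Definition qmc_quot_dim (B : 'I_N -> 'M[F]_M) (ql lb : F) : nat :=
  (N * M - \rank (qmc_KL B ql lb))%N.

End QMiddleConvolution.

Definition mxpoly3 (F : fieldType) (n : nat) (A1 A2 : 'M[F]_n) (k : F)
  : 'M[{poly F}]_n :=
  \matrix_(i, j) ((i == j)%:R%:P + (A1 i j)%:P * 'X + (A2 i j)%:P * 'X^2
                  + ((i == j)%:R * k)%:P * 'X^3).

Definition mxval3 (F : fieldType) (n : nat) (A1 A2 : 'M[F]_n) (k x : F)
  : 'M[F]_n :=
  1%:M + x *: A1 + x ^+ 2 *: A2 + (k * x ^+ 3)%:M.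

Definition first3 (T : Type) (e : 'I_9 -> T) (i : 'I_3) : T :=
  e (widen_ord (isT : (3 <= 9)%N) i).

(* Main.v *)
Require Import Defs.
From HB Require Import structures.
From mathcomp Require Import all_boot all_order all_algebra.
From mathcomp Require Import mxtens complex.
From mathcomp Require Import reals.
From mathcomp Require Import ring zify.
Set Implicit Arguments. Unset Strict Implicit. Unset Printing Implicit Defensive.
Import Order.TTheory GRing.Theory Num.Theory.
Local Open Scope ring_scope.

(** Comparing residues and leading coefficients, [A_i] is a nonzero multiple of
    [A(-e_i)] and [(1-q)(A_1+A_2+A_3) = (1 - kappa e_1 e_2 e_3) I].  Since
    [-e_i] is a simple zero of [det A], each [A_i] has a one-dimensional kernel,
    so [dim K = 3]; and [q^lambda = (kappa e_1 e_2 e_3)^-1] is exactly the value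
    making [L] the diagonal [{(w,w,w)}].  As the [A_i] have no common kernel,
    [K] and [L] are independent and the quotient has dimension [9 - 6 = 3].

    Let [H(x) = I - (1-q) x sum_i G_i/(x+e_i)] and [y = q^lambda x].  On [K] it
    acts with eigenvalues [d_i = (y+e_i)/(x+e_i)], on [L] as the identity, and
    on the whole space [H(x)] is a block scalar matrix plus a matrix factoring
    through [C^3], so that [det H(x) = (d_1 d_2 d_3)^3 det A'(y)].  Dividing
    gives the determinant on the quotient. *)

(** * Determinants of low-rank perturbations and of maps preserving a subspace *)

(** The block matrix with rows [(1, Y)] and [(X, D)] has two triangular factorisations, one for each
    Schur complement; comparing determinants gives the identity. *)
Lemma det_sub_mul (F : comUnitRingType) (m n : nat) (D D' : 'M[F]_n)
  (X : 'M[F]_(n, m)) (Y : 'M[F]_(m, n)) :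
  D *m D' = 1%:M -> \det (D - X *m Y) = \det D * \det (1%:M - Y *m D' *m X).
Proof.
move=> DD'; have D'D : D' *m D = 1%:M by apply: mulmx1C.
have e1 : block_mx 1%:M Y X D =
    block_mx 1%:M 0 X 1%:M *m block_mx 1%:M Y 0 (D - X *m Y).
  rewrite mulmx_block ?mul1mx ?mul0mx ?mulmx1 ?mulmx0 ?addr0.
  by rewrite addrC subrK.
have e2 : block_mx 1%:M Y X D =
    block_mx (1%:M - Y *m D' *m X) Y 0 D *m block_mx 1%:M 0 (D' *m X) 1%:M.
  rewrite mulmx_block ?mulmx1 ?mul0mx ?mulmx0 ?add0r.
  by rewrite !mulmxA DD' mul1mx subrK.
move: (congr1 (fun A => \det A) e1); rewrite {1}e2 !det_mulmx !det_ublock.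
by rewrite !det_lblock !det1 !mul1r !mulr1 mulrC => ->.
Qed.

(* With sections P' of P and S of U, the matrix of H between the frames
   (P; S) and (P', U) is block triangular, and their product is unipotent. *)
Lemma det_sub_quot (F : fieldType) (n m k : nat) (H : 'M[F]_n) (P : 'M[F]_(m, n))
  (Hb : 'M[F]_m) (U : 'M[F]_(n, k)) (T : 'M[F]_k) :
  n = (m + k)%N -> row_free P -> row_free U^T -> P *m U = 0 ->
  Hb *m P = P *m H -> H *m U = U *m T -> \det H = \det Hb * \det T.
Proof.
move=> enmk; subst n => /row_freeP[P' PP'] /row_freeP[S' US'] PU HP HU.
have SU : S'^T *m U = 1%:M by rewrite -[U]trmxK -trmx_mul US' trmx1.
set S := S'^T in SU.
have QW : \det (col_mx P S) * \det (row_mx P' U) = 1.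
  by rewrite -det_mulmx mul_col_row PP' PU SU det_lblock !det1 mulr1.
have QHW : col_mx P S *m H *m row_mx P' U = block_mx Hb 0 (S *m H *m P') T.
  rewrite mul_col_mx mul_col_row -HP -!mulmxA PP' PU HU mulmx1 mulmx0.
  by rewrite [S *m (U *m T)]mulmxA SU mul1mx mulmxA.
move: (congr1 (fun A => \det A) QHW); rewrite det_lblock !det_mulmx => <-.
by rewrite mulrAC QW mul1r.
Qed.

(** * Block calculus on the direct sum of [N] copies of [F^M] *)

Section Blocks.
Variables (F : fieldType) (N M : nat).

(** Inclusion of the [i]-th summand; its transpose is the projection onto that summand. *)
Definition blk (i : 'I_N) : 'M[F]_(N * M, M) :=
  \matrix_(a, r) (mxtens_unindex a == (i, r))%:R.

Lemma mul_blkE p (i : 'I_N) (X : 'M[F]_(M, p)) a b :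
  (blk i *m X) a b =
  if (mxtens_unindex a).1 == i then X (mxtens_unindex a).2 b else 0.
Proof.
rewrite mxE; case ea: (mxtens_unindex a) => [j r] /=.
case: eqP => [eji|nji].
  rewrite (bigD1 r) //= big1 ?addr0 => [|s nsr].
    by rewrite mxE ea eji eqxx mul1r.
  by rewrite mxE ea xpair_eqE [r == s]eq_sym (negPf nsr) andbF mul0r.
rewrite big1 // => s _; rewrite mxE ea xpair_eqE.
by move/eqP/negPf: nji => ->; rewrite mul0r.
Qed.

Lemma mul_trblkE p (j : 'I_N) (X : 'M[F]_(p, M)) a b :
  (X *m (blk j)^T) a b =
  if (mxtens_unindex b).1 == j then X a (mxtens_unindex b).2 else 0.
Proof.
have -> : X *m (blk j)^T = (blk j *m X^T)^T by rewrite trmx_mul trmxK.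
by rewrite mxE mul_blkE; case: eqP; rewrite ?mxE.
Qed.

Lemma tr_blk_mul i j : (blk i)^T *m blk j = (i == j)%:R%:M.
Proof.
apply/matrixP => r s; rewrite !mxE.
rewrite (bigD1 (mxtens_index (i, r))) //= big1 ?addr0 => [|a na].
  rewrite !mxE mxtens_indexK eqxx mul1r xpair_eqE.
  by case: (i == j); case: (r == s).
rewrite !mxE; case: eqP => [ea|]; last by rewrite mul0r.
by case/negP: na; rewrite -ea mxtens_unindexK.
Qed.

Lemma sum_blk_tr : \sum_i blk i *m (blk i)^T = 1%:M.
Proof.
apply/matrixP => a b; rewrite summxE.
case: (mxtens_indexP a) => i r; case: (mxtens_indexP b) => j s.
rewrite (bigD1 i) //= big1 ?addr0 => [|k nk].
  rewrite mul_blkE !mxE !mxtens_indexK /= eqxx.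
  rewrite (can_eq (@mxtens_indexK _ _)) /= !xpair_eqE.
  by rewrite [j == i]eq_sym [s == r]eq_sym.
by rewrite mul_blkE mxtens_indexK /= eq_sym (negPf nk).
Qed.

Definition blkrow (B : 'I_N -> 'M[F]_M) : 'M[F]_(M, N * M) :=
  \sum_j B j *m (blk j)^T.

Lemma blkrow_mul B i : blkrow B *m blk i = B i.
Proof.
rewrite mulmx_suml (bigD1 i) //= big1 ?addr0 => [|j nji].
  by rewrite -mulmxA tr_blk_mul eqxx mulmx1.
by rewrite -mulmxA tr_blk_mul (negPf nji) -scalemx1 scale0r mulmx0.
Qed.

(** Index-free form of [G_k]: the [ql] part of every [G_k] factors through the single map [blkrow B]
    to [F^M], which is what later reduces an [NM]-dimensional determinant to an [M]-dimensional
    one. *)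
Lemma qmc_GE B ql lb k :
  qmc_G B ql lb k = blk k *m (ql *: blkrow B + lb *: (blk k)^T).
Proof.
apply/matrixP => a b; rewrite mul_blkE !mxE.
case: (mxtens_indexP a) => i r; case: (mxtens_indexP b) => j s.
rewrite !mxtens_indexK /=; case: (i == k) => //.
rewrite summxE (bigD1 j) //= mul_trblkE mxtens_indexK /= eqxx.
rewrite big1 ?addr0 => [|l nl].
  by rewrite xpair_eqE [s == r]eq_sym [in RHS]mulrC [lb * _]mulrC [_ * ql]mulrC.
by rewrite mul_trblkE mxtens_indexK /= eq_sym (negPf nl).
Qed.

Lemma qmc_KE B :
  qmc_K B = \sum_i blk i *m kermx (B i)^T *m (blk i)^T.
Proof.
apply/matrixP => a b; rewrite summxE !mxE.
case: (mxtens_indexP a) => i r; case: (mxtens_indexP b) => j s.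
rewrite !mxtens_indexK /=.
rewrite (bigD1 i) //= -mulmxA mul_blkE mxtens_indexK eqxx /=.
rewrite mul_trblkE mxtens_indexK /= [j == i]eq_sym.
rewrite big1 ?addr0 // => k nk.
by rewrite -mulmxA mul_blkE mxtens_indexK /= eq_sym (negPf nk).
Qed.

Definition blkdiag (d : 'I_N -> F) : 'M[F]_(N * M) :=
  \sum_i d i *: (blk i *m (blk i)^T).

Lemma blkdiag_blk d i : blkdiag d *m blk i = d i *: blk i.
Proof.
rewrite mulmx_suml (bigD1 i) //= big1 ?addr0 => [|j nji].
  by rewrite -scalemxAl -mulmxA tr_blk_mul eqxx mulmx1.
by rewrite -scalemxAl -mulmxA tr_blk_mul (negPf nji) -scalemx1 scale0r mulmx0 scaler0.
Qed.

Lemma blkdiag_mulV d : (forall i, d i != 0) ->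
  blkdiag d *m blkdiag (fun i => (d i)^-1) = 1%:M.
Proof.
move=> d0; rewrite mulmx_sumr -sum_blk_tr; apply: eq_bigr => i _.
by rewrite -scalemxAr mulmxA blkdiag_blk -scalemxAl scalerA mulVf // scale1r.
Qed.

Lemma det_blkdiag d : \det (blkdiag d) = \prod_i d i ^+ M.
Proof.
have -> : blkdiag d = diag_mx (\row_a d (mxtens_unindex a).1).
  apply/matrixP => a b; rewrite summxE !mxE.
  case: (mxtens_indexP a) => i r; case: (mxtens_indexP b) => j s.
  rewrite mxtens_indexK /= (can_eq (@mxtens_indexK _ _)) /= xpair_eqE.
  rewrite (bigD1 i) //= big1 ?addr0 => [|k nk].
    rewrite mxE mul_blkE mxtens_indexK eqxx !mxE mxtens_indexK xpair_eqE /=.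
    rewrite [s == r]eq_sym [j == i]eq_sym mulr_natr; by [].
  by rewrite mxE mul_blkE mxtens_indexK /= eq_sym (negPf nk) mulr0.
rewrite det_diag (reindex (@mxtens_index N M)) /=; last first.
  by exists (@mxtens_unindex N M) => a _; rewrite ?mxtens_indexK ?mxtens_unindexK.
rewrite (eq_bigr (fun ir => d ir.1)) => [|ir _]; last first.
  by rewrite mxE -[in RHS](mxtens_indexK ir).
rewrite -(pair_bigA _ (fun i (_ : 'I_M) => d i)) /=.
by apply: eq_bigr => i _; rewrite prodr_const card_ord.
Qed.

End Blocks.

(** * The subspaces K and L, and the determinant on the quotient *)

Section QuotientDet.
Variables (F : fieldType) (N M : nat) (B : 'I_N -> 'M[F]_M) (ql lb : F).
Variable k : 'I_N -> 'cV[F]_M.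

Local Notation E := (@blk F N M).
Local Notation G := (qmc_G B ql lb).

(** Column [i] is [k i] placed in block [i]; once [k i] spans [Ker B_i], the columns form a basis of
    K. *)
Definition basisK : 'M[F]_(N * M, N) := \sum_i E i *m k i *m delta_mx 0 i.
(** The diagonal embedding sending [w] to [(w, ..., w)]. *)
Definition basisL : 'M[F]_(N * M, M) := \sum_i E i.
Definition basisKL := row_mx basisK basisL.

Lemma sum_qmc_G : \sum_i G i = basisL *m (ql *: blkrow B) + lb%:M.
Proof.
rewrite /basisL mulmx_suml -scalemx1 -sum_blk_tr [lb *: _]scaler_sumr -big_split /=.
by apply: eq_bigr => i _; rewrite qmc_GE mulmxDr -!scalemxAr.
Qed.

Lemma blkrow_basisL : blkrow B *m basisL = \sum_i B i.
Proof. by rewrite mulmx_sumr; apply: eq_bigr => i _; rewrite blkrow_mul. Qed.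

Lemma tr_blk_basisL i : (E i)^T *m basisL = 1%:M.
Proof.
rewrite mulmx_sumr (bigD1 i) //= big1 ?addr0 => [|j nji].
  by rewrite tr_blk_mul eqxx.
by rewrite tr_blk_mul eq_sym (negPf nji) -scalemx1 scale0r.
Qed.

Lemma tr_blk_basisK i : (E i)^T *m basisK = k i *m delta_mx 0 i.
Proof.
rewrite mulmx_sumr (bigD1 i) //= big1 ?addr0 => [|j nji].
  by rewrite !mulmxA tr_blk_mul eqxx mul1mx.
by rewrite !mulmxA tr_blk_mul eq_sym (negPf nji) -scalemx1 scale0r !mul0mx.
Qed.

Lemma basisK_delta i : basisK *m delta_mx i 0 = E i *m k i.
Proof.
rewrite mulmx_suml (bigD1 i) //= big1 ?addr0 => [|j nji].
  by rewrite -mulmxA mul_delta_mx [delta_mx 0 0]mx11_scalar mxE !eqxx mulmx1.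
by rewrite -mulmxA mul_delta_mx_0 ?mulmx0.
Qed.

Hypothesis k_neq0 : forall i, k i != 0.
Hypothesis Bk : forall i, B i *m k i = 0.
Hypothesis ker_sub : forall i, (kermx (B i)^T <= (k i)^T)%MS.
Hypothesis lb_neq0 : lb != 0.
Hypothesis sumB : ql *: (\sum_i B i) = - lb%:M.
Hypothesis capB : forall v : 'cV[F]_M, (forall i, B i *m v = 0) -> v = 0.

Lemma qmc_K_eq : (qmc_K B :=: basisK^T)%MS.
Proof.
apply/eqmxP/andP; split.
  rewrite qmc_KE; apply: summx_sub => i _.
  rewrite -mulmxA; apply: mulmx_sub.
  have /submxP[D ->] := ker_sub i.
  rewrite -mulmxA -trmx_mul -basisK_delta trmx_mul; apply: mulmx_sub.
  exact: submxMl.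
apply/row_subP => i; rewrite -tr_col colE basisK_delta trmx_mul.
have : ((k i)^T <= kermx (B i)^T)%MS.
  by apply/sub_kermxP; rewrite -trmx_mul Bk trmx0.
case/submxP => D ->; rewrite -mulmxA.
have -> : kermx (B i)^T *m (E i)^T = (E i)^T *m qmc_K B.
  rewrite qmc_KE mulmx_sumr (bigD1 i) //= big1 ?addr0 => [|j nji].
    by rewrite !mulmxA tr_blk_mul eqxx mul1mx.
  by rewrite !mulmxA tr_blk_mul eq_sym (negPf nji) -scalemx1 scale0r !mul0mx.
by rewrite mulmxA submxMl.
Qed.

(** By [sumB], the sum of the [G_i] kills the diagonal. Conversely this sum is [lb] times the
    identity plus a map with diagonal image, so, as [lb] is nonzero, every vector of its kernel is
    diagonal. *)
Lemma qmc_L_eq : (qmc_L B ql lb :=: basisL^T)%MS.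
Proof.
apply/eqmxP/andP; split; last first.
  apply/sub_kermxP; rewrite -trmx_mul sum_qmc_G mulmxDl -mulmxA -scalemxAl.
  by rewrite blkrow_basisL sumB mulmxN mul_mx_scalar mul_scalar_mx addNr trmx0.
have /eqP := mulmx_ker (\sum_i G i)^T; rewrite -/(qmc_L B ql lb).
rewrite sum_qmc_G linearD /= tr_scalar_mx mulmxDr mul_mx_scalar trmx_mul mulmxA.
rewrite addrC addr_eq0 => /eqP eL.
rewrite -[qmc_L _ _ _]scale1r -(mulVf lb_neq0) -scalerA eL -mulNmx.
by apply: scalemx_sub; apply: submxMl.
Qed.

Lemma qmc_KL_eq : (qmc_KL B ql lb :=: basisKL^T)%MS.
Proof.
rewrite /qmc_KL /basisKL tr_row_mx.
apply: (eqmx_trans (adds_eqmx qmc_K_eq qmc_L_eq)); exact: addsmxE.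
Qed.

(** In block [i] a linear relation reads [a_i k_i + b = 0]. Applying [B_i] gives [B_i b = 0] for all
    [i], so [b = 0] by [capB], and then each [a_i] vanishes. *)
Lemma row_free_basisKL : row_free basisKL^T.
Proof.
apply: inj_row_free => v; rewrite -[v]trmxK -trmx_mul => /(canRL (@trmxK _ _ _)).
rewrite trmx0; move: v^T => {v} w; rewrite -[w]vsubmxK.
set a := usubmx w; set b := dsubmx w => Uw.
have eqi i : a i 0 *: k i + b = 0.
  have: (E i)^T *m (basisKL *m col_mx a b) = 0 by rewrite Uw mulmx0.
  rewrite mul_row_col mulmxDr !mulmxA tr_blk_basisL mul1mx tr_blk_basisK => <-.
  congr (_ + _); rewrite -mulmxA -rowE.
  by rewrite [row i a]mx11_scalar mul_mx_scalar [row i a 0 0]mxE.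
have b0 : b = 0.
  apply: capB => i; have := congr1 (mulmx (B i)) (eqi i).
  by rewrite mulmxDr -scalemxAr Bk scaler0 add0r mulmx0.
have a0 : a = 0.
  apply/colP => i; have /eqP := eqi i; rewrite b0 addr0 scaler_eq0.
  by rewrite (negPf (k_neq0 i)) orbF => /eqP ->; rewrite mxE.
by rewrite a0 b0 col_mx0 trmx0.
Qed.

Lemma rank_qmc_KL : \rank (qmc_KL B ql lb) = (N + M)%N.
Proof. by rewrite qmc_KL_eq; apply/eqP; exact: row_free_basisKL. Qed.

(** The weights [w i = (1-q) x / (x + e_i)] turn this into H(x). *)
Definition pencil (w : 'I_N -> F) : 'M[F]_(N * M) := 1%:M - \sum_i w i *: G i.

Lemma qmc_G_blk i j : G i *m E j = E i *m (ql *: B j + ((i == j)%:R * lb)%:M).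
Proof.
rewrite qmc_GE -mulmxA mulmxDl -!scalemxAl blkrow_mul tr_blk_mul.
by rewrite scale_scalar_mx mulrC.
Qed.

(** Since [B_i k_i = 0], the vector [E_i k_i] is an eigenvector of [G_i] for [lb] and is killed by
    the other [G_j]. *)
Lemma pencil_basisK w :
  pencil w *m basisK = basisK *m diag_mx (\row_i (1 - lb * w i)).
Proof.
have col_eq i : pencil w *m (E i *m k i) = (1 - lb * w i) *: (E i *m k i).
  rewrite mulmxBl mul1mx mulmx_suml (bigD1 i) //= big1 ?addr0 => [|j nji].
    rewrite -scalemxAl mulmxA qmc_G_blk eqxx mul1r -mulmxA mulmxDl -scalemxAl.
    rewrite Bk scaler0 add0r mul_scalar_mx -scalemxAr scalerA.
    by rewrite scalerBl scale1r mulrC.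
  rewrite -scalemxAl mulmxA qmc_G_blk (negPf nji) mul0r -mulmxA mulmxDl.
  by rewrite -scalemxAl Bk scaler0 add0r -scalemx1 scale0r mul0mx mulmx0 scaler0.
rewrite {1}/basisK mulmx_sumr {1}/basisK mulmx_suml; apply: eq_bigr => i _.
rewrite mulmxA col_eq -scalemxAl -[RHS]mulmxA scalemxAr; congr (_ *m _).
apply/rowP => j; rewrite mul_mx_diag !mxE eqxx /=.
by case: eqP => [->|_]; rewrite ?mul1r ?mulr1 ?mul0r ?mulr0.
Qed.

(** Each [G_i] separately kills the diagonal: block [i] of the image of [(w, ..., w)] is
    [ql (\sum_j B_j) w + lb w], which vanishes by [sumB]. *)
Lemma pencil_basisL w : pencil w *m basisL = basisL.
Proof.
rewrite mulmxBl mul1mx mulmx_suml big1 ?subr0 // => i _.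
rewrite -scalemxAl qmc_GE -mulmxA mulmxDl -!scalemxAl blkrow_basisL sumB.
by rewrite tr_blk_basisL scalemx1 addNr mulmx0 scaler0.
Qed.

Lemma pencil_basisKL w : pencil w *m basisKL =
  basisKL *m block_mx (diag_mx (\row_i (1 - lb * w i))) 0 0 1%:M.
Proof.
rewrite mul_mx_row pencil_basisK pencil_basisL mul_row_block.
by rewrite !mulmx0 mulmx1 addr0 add0r.
Qed.

(** The scalar parts of the [G_i] form the block scalar matrix with entries [1 - lb * w i]; the rest
    factors through [blkrow B], so [det_sub_mul] applies. *)
Lemma det_pencil w : (forall i, 1 - lb * w i != 0) ->
  \det (pencil w) = \prod_i (1 - lb * w i) ^+ M *
    \det (1%:M - \sum_i (ql * w i / (1 - lb * w i)) *: B i).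
Proof.
move=> d0; have -> : pencil w = blkdiag M (fun i => 1 - lb * w i)
    - (\sum_i (ql * w i) *: E i) *m blkrow B.
  rewrite /pencil /blkdiag -sum_blk_tr mulmx_suml -!sumrB; apply: eq_bigr => i _.
  rewrite qmc_GE mulmxDr -!scalemxAr -!scalemxAl scalerDr !scalerA scalerBl scale1r.
  by rewrite opprD [w i * ql]mulrC [w i * lb]mulrC addrAC addrA.
rewrite (det_sub_mul _ _ (blkdiag_mulV M d0)) det_blkdiag; congr (_ * \det (_ - _)).
rewrite mulmx_sumr; apply: eq_bigr => i _.
by rewrite -scalemxAr -mulmxA blkdiag_blk -scalemxAr blkrow_mul scalerA.
Qed.

Section Quotient.
Variables (m : nat) (P : 'M[F]_(m, N * M)) (Gb : 'I_N -> 'M[F]_m).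
Hypothesis Pfree : row_free P.
Hypothesis PKL :
  forall v : 'cV[F]_(N * M), (v^T <= qmc_KL B ql lb)%MS -> P *m v = 0.
Hypothesis GbP : forall i, Gb i *m P = P *m G i.

Lemma mul_basisKL_eq0 : P *m basisKL = 0.
Proof.
apply: (can_inj (@trmxK _ _ _)); rewrite trmx0.
apply/row_matrixP => j; rewrite row0 -tr_col colE -mulmxA -colE PKL ?trmx0 //.
by rewrite tr_col qmc_KL_eq row_sub.
Qed.

(** The non-scalar part of the sum of the [G_i] has image in L, hence disappears in the quotient.
    This later fixes the leading coefficient of the new polynomial. *)
Lemma sum_qmc_quot : \sum_i Gb i = lb%:M.
Proof.
apply: (row_free_inj Pfree); rewrite /= mulmx_suml.
under eq_bigr => i _ do rewrite GbP.
rewrite -mulmx_sumr sum_qmc_G mulmxDr mulmxA.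
have: P *m basisKL = row_mx 0 0 by rewrite mul_basisKL_eq0 row_mx0.
rewrite mul_mx_row => /eq_row_mx[_ ->].
by rewrite mul0mx add0r mul_mx_scalar mul_scalar_mx.
Qed.

(** Two computations of the determinant of [pencil w]: through K + L and the quotient, and through
    [det_pencil]. The dimension equation makes K + L the whole kernel of [P]. *)
Lemma det_qmc_quot w :
  (N * M = m + (N + M))%N -> (forall i, 1 - lb * w i != 0) ->
  \det (1%:M - \sum_i w i *: Gb i) * \prod_i (1 - lb * w i) =
  \prod_i (1 - lb * w i) ^+ M *
    \det (1%:M - \sum_i (ql * w i / (1 - lb * w i)) *: B i).
Proof.
move=> dimE d0; rewrite -det_pencil //.
rewrite (det_sub_quot dimE Pfree row_free_basisKL mul_basisKL_eq0 _
  (pencil_basisKL w) (Hb := 1%:M - \sum_i w i *: Gb i)).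
  rewrite det_ublock det1 mulr1 det_diag; congr (_ * _).
  by apply: eq_bigr => i _; rewrite mxE.
rewrite mulmxBl mulmxBr mul1mx mulmx1 mulmx_suml mulmx_sumr; congr (_ - _).
by apply: eq_bigr => i _; rewrite -scalemxAl -scalemxAr GbP.
Qed.

End Quotient.
End QuotientDet.

(** * Rank drop at a point and order of vanishing of the determinant *)

(** Constant invertible row and column operations bring the value at [a] to [pid_mx r]; all rows
    from [r] on are then divisible by ['X - a]. *)
Lemma dvdp_det_horner_rank (F : fieldType) (n : nat) (A : 'M[{poly F}]_n) (a : F) :
  ('X - a%:P) ^+ (n - \rank (map_mx (horner_eval a) A)) %| \det A.
Proof.
set A0 := map_mx _ _; set r := \rank A0; set t := 'X - a%:P.
pose L : 'M[{poly F}]_n := map_mx polyC (col_ebase A0).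
pose U : 'M[{poly F}]_n := map_mx polyC (row_ebase A0).
pose L' : 'M[{poly F}]_n := map_mx polyC (invmx (col_ebase A0)).
pose U' : 'M[{poly F}]_n := map_mx polyC (invmx (row_ebase A0)).
have LL' : L *m L' = 1%:M by rewrite -map_mxM mulmxV ?col_ebase_unit // map_mx1.
have U'U : U' *m U = 1%:M by rewrite -map_mxM mulVmx ?row_ebase_unit // map_mx1.
(* The division is exact, because [A] minus its value at [a] vanishes at [a]. *)
pose C : 'M[{poly F}]_n := \matrix_(i, j) ((A i j - (A0 i j)%:P) %/ t).
have eA : A = map_mx polyC A0 + t *: C.
  apply/matrixP => i j; rewrite !mxE mulrC divpK; first by rewrite addrC subrK.
  by rewrite dvdp_XsubCl /root !hornerE subrr.
pose C' := L' *m C *m U'.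
pose A' : 'M[{poly F}]_n := pid_mx r + t *: C'.
have eA' : A = L *m A' *m U.
  rewrite mulmxDr mulmxDl -scalemxAr -scalemxAl /C' !mulmxA LL' mul1mx.
  rewrite -[C *m U' *m U]mulmxA U'U mulmx1 [LHS]eA; congr (_ + _).
  by rewrite -(map_pid_mx polyC) -!map_mxM mulmx_ebase.
pose D : 'rV[{poly F}]_n := \row_i (if (r <= i)%N then t else 1).
have eD : A' = diag_mx D *m (\matrix_(i, j) if (r <= i)%N then C' i j else A' i j).
  apply/matrixP => i j; rewrite mul_diag_mx !mxE.
  case: leqP => ri; last by rewrite mul1r.
  by rewrite andbF add0r.
rewrite eA' eD !det_mulmx det_diag.
apply: dvdp_mulr; apply: dvdp_mull; apply: dvdp_mulr.
rewrite (eq_bigr (fun i : 'I_n => if (r <= i)%N then t else 1)) => [|i _]; last first.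
  by rewrite mxE.
by rewrite -big_mkcond -prodr_const_nat big_geq_mkord.
Qed.

(** * Identities valid off finitely many points, and residues *)

(** The roots of [g] are the excluded points. The product [(p - q) * g] vanishes everywhere, in
    particular at as many distinct naturals as its size, one more than its degree could allow. *)
Lemma poly_eq_cofinite (F : numFieldType) (p q g : {poly F}) :
  g != 0 -> (forall x, g.[x] != 0 -> p.[x] = q.[x]) -> p = q.
Proof.
move=> g0 pq; apply/eqP; rewrite -subr_eq0; apply/negPn/negP => d0.
have nz : (p - q) * g != 0 by rewrite mulf_neq0.
pose rs := [seq (i%:R : F) | i <- iota 0 (size ((p - q) * g))].
have ur : uniq rs by rewrite map_inj_uniq ?iota_uniq //; exact: (mulrIn (oner_neq0 F)).
suff /max_poly_roots /(_ ur) : all (root ((p - q) * g)) rs.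
  by move=> /(_ nz); rewrite size_map size_iota ltnn.
apply/allP => x _; rewrite rootM /root !hornerE.
by have [gx|gx] := eqVneq g.[x] 0; rewrite ?orbT // pq // subrr eqxx.
Qed.

Lemma map_horner_mxpoly3 (F : fieldType) n (A1 A2 : 'M[F]_n) k x :
  map_mx (horner_eval x) (mxpoly3 A1 A2 k) = mxval3 A1 A2 k x.
Proof.
apply/matrixP => i j; rewrite !mxE /= /horner_eval !hornerE /=.
by case: (i == j); rewrite ?mulr1n ?mulr0n; ring.
Qed.

Lemma horner_det_mxpoly3 (F : fieldType) n (A1 A2 : 'M[F]_n) k x :
  (\det (mxpoly3 A1 A2 k)).[x] = \det (mxval3 A1 A2 k x).
Proof. by rewrite -map_horner_mxpoly3 det_map_mx. Qed.

Lemma quadratic_eq0 (F : numFieldType) (k0 k1 k2 : F) (g : {poly F}) :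
  g != 0 -> (forall x, g.[x] != 0 -> k0 + k1 * x + k2 * x ^+ 2 = 0) ->
  [/\ k0 = 0, k1 = 0 & k2 = 0].
Proof.
move=> g0 h; have e : k0%:P + k1 *: 'X + k2 *: 'X^2 = 0.
  by apply: (poly_eq_cofinite g0) => x /h; rewrite !hornerE.
by split; [have := congr1 (fun p : {poly F} => p`_0) e
  | have := congr1 (fun p : {poly F} => p`_1) e
  | have := congr1 (fun p : {poly F} => p`_2) e];
  rewrite !coefE /= ?mulr0 ?mulr1 ?addr0 ?add0r.
Qed.

(** One matrix entry at a time: [d] stands for the Kronecker delta, [u] and [v] for entries of the
    coefficients. Clearing denominators and dividing by [x] leaves a quadratic in [x] that must
    vanish identically. *)
Lemma residues3 (F : numFieldType) (c f0 f1 f2 a0 a1 a2 d u v k : F) :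
  c != 0 -> f0 != 0 -> f1 != 0 -> f2 != 0 ->
  (forall x, x != 0 -> x + f0 != 0 -> x + f1 != 0 -> x + f2 != 0 ->
     (x + f0)^-1 * a0 + (x + f1)^-1 * a1 + (x + f2)^-1 * a2 =
     (c * x)^-1 * (d - ((1 + x / f0) * (1 + x / f1) * (1 + x / f2))^-1 *
       (d + x * u + x ^+ 2 * v + d * (k * x ^+ 3)))) ->
  let p := f0 * f1 * f2 in
  let val x := d + x * u + x ^+ 2 * v + d * (k * x ^+ 3) in
  [/\ c * (a0 + a1 + a2) = d * (1 - k * p),
      c * f0 * (f1 - f0) * (f2 - f0) * a0 = p * val (- f0),
      c * f1 * (f0 - f1) * (f2 - f1) * a1 = p * val (- f1) &
      c * f2 * (f0 - f2) * (f1 - f2) * a2 = p * val (- f2)].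
Proof.
move=> c0 f00 f10 f20 h p val.
pose g := 'X * ('X + f0%:P) * ('X + f1%:P) * ('X + f2%:P) : {poly F}.
have g0 : g != 0 by rewrite !mulf_neq0 ?polyX_eq0 // monic_neq0 // monicXaddC.
have [] := @quadratic_eq0 F
  (c * (f1 * f2 * a0 + f0 * f2 * a1 + f0 * f1 * a2)
     - (f0 * f1 + f0 * f2 + f1 * f2) * d + p * u)
  (c * ((f1 + f2) * a0 + (f0 + f2) * a1 + (f0 + f1) * a2)
     - (f0 + f1 + f2) * d + p * v)
  (c * (a0 + a1 + a2) - d * (1 - k * p)) g g0.
  move=> x; rewrite !hornerE !mulf_eq0 !negb_or -!andbA => /and4P[x0 xf0 xf1 xf2].
  have := h x x0 xf0 xf1 xf2.
  move/eqP; rewrite -subr_eq0 => /eqP e.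
  apply: (mulfI x0); rewrite mulr0.
  rewrite -[RHS](mulr0 (c * x * (x + f0) * (x + f1) * (x + f2))) -e /p /=.
  by field; rewrite ![_ + x]addrC f20 f10 f00 xf2 xf1 xf0 x0.
move=> k0 k1 k2; split; apply/eqP; rewrite -subr_eq0; apply/eqP.
- exact: k2.
(* The quadratic is evaluated at [- f0], where only the [a0] term survives among the residues, and
   multiplied by [f0]; the next two cases use [- f1] and [- f2]. *)
- transitivity (f0 * (0 - f0 * 0 + f0 ^+ 2 * 0)); last by ring.
  by rewrite -{1}k0 -{1}k1 -{1}k2 /val /p; ring.
- transitivity (f1 * (0 - f1 * 0 + f1 ^+ 2 * 0)); last by ring.
  by rewrite -{1}k0 -{1}k1 -{1}k2 /val /p; ring.
- transitivity (f2 * (0 - f2 * 0 + f2 ^+ 2 * 0)); last by ring.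
  by rewrite -{1}k0 -{1}k1 -{1}k2 /val /p; ring.
Qed.

(** * Residues of the matrix polynomial at three points *)

Local Notation o0 := (@Ordinal 3 0 isT).
Local Notation o1 := (@Ordinal 3 1 isT).
Local Notation o2 := (@Ordinal 3 2 isT).

Lemma ord3_ind (P : 'I_3 -> Prop) : P o0 -> P o1 -> P o2 -> forall i, P i.
Proof.
move=> P0 P1 P2 [[|[|[|//]]] lti].
- by rewrite (_ : Ordinal lti = o0) //; apply: val_inj.
- by rewrite (_ : Ordinal lti = o1) //; apply: val_inj.
- by rewrite (_ : Ordinal lti = o2) //; apply: val_inj.
Qed.

Lemma big_ord3 (T : Type) (idx : T) (op : Monoid.law idx) (f : 'I_3 -> T) :
  \big[op/idx]_(i < 3) f i = op (op (f o0) (f o1)) (f o2).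
Proof.
rewrite !big_ord_recr big_ord0 /= Monoid.mul1m.
by congr (op (op (f _) (f _)) (f _)); apply: val_inj.
Qed.

Lemma mxval3E (F : fieldType) n (A1 A2 : 'M[F]_n) k x i j :
  mxval3 A1 A2 k x i j = (i == j)%:R + x * A1 i j + x ^+ 2 * A2 i j
    + (i == j)%:R * (k * x ^+ 3).
Proof. by rewrite !mxE mulr_natl. Qed.

Lemma residues_mxval3 (F : numFieldType) (n : nat) (c kappa : F) (f : 'I_3 -> F)
  (A1 A2 : 'M[F]_n) (Ar : 'I_3 -> 'M[F]_n) :
  c != 0 -> (forall i, f i != 0) -> injective f ->
  (forall x : F, x != 0 -> (forall i : 'I_3, x + f i != 0) ->
     \sum_(i < 3) (x + f i)^-1 *: Ar i =
     (c * x)^-1 *: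
       (1%:M - (\prod_(i < 3) (1 + x / f i))^-1 *: mxval3 A1 A2 kappa x)) ->
  (forall i, exists2 s, s != 0 & Ar i = s *: mxval3 A1 A2 kappa (- f i)) /\
  c *: (\sum_i Ar i) = (1 - kappa * \prod_(i < 3) f i)%:M.
Proof.
move=> c0 f0 finj h.
have ent i j x : x != 0 -> x + f o0 != 0 -> x + f o1 != 0 -> x + f o2 != 0 ->
     (x + f o0)^-1 * Ar o0 i j + (x + f o1)^-1 * Ar o1 i j
       + (x + f o2)^-1 * Ar o2 i j =
     (c * x)^-1 * ((i == j)%:R -
       ((1 + x / f o0) * (1 + x / f o1) * (1 + x / f o2))^-1 *
       ((i == j)%:R + x * A1 i j + x ^+ 2 * A2 i j
          + (i == j)%:R * (kappa * x ^+ 3))).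
  move=> x0 x1 x2 x3; rewrite -mxval3E.
  have := h x x0 (@ord3_ind (fun i => x + f i != 0) x1 x2 x3).
  move: (mxval3 A1 A2 kappa x) => V; rewrite !big_ord3 => /matrixP/(_ i j).
  by rewrite !mxE.
have {ent}res i j := residues3 c0 (f0 o0) (f0 o1) (f0 o2) (ent i j).
have sub_f i j : i != j -> f j - f i != 0.
  by move=> nij; rewrite subr_eq0 (inj_eq finj) eq_sym.
split; last first.
  apply/matrixP => i j; rewrite mxE summxE !big_ord3 /=.
  by have [-> _ _ _] := res i j; rewrite mxE mulr_natl.
pose p := f o0 * f o1 * f o2; have p0 : p != 0 by rewrite !mulf_neq0.
apply: ord3_ind.
- exists (p / (c * f o0 * (f o1 - f o0) * (f o2 - f o0))).
    by rewrite !mulf_neq0 ?invr_eq0 ?mulf_neq0 // sub_f.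
  apply/matrixP => i j; rewrite mxE mxval3E; have [_ e _ _] := res i j.
  by rewrite mulrAC -e mulrAC mulfV ?mul1r // !mulf_neq0 // sub_f.
- exists (p / (c * f o1 * (f o0 - f o1) * (f o2 - f o1))).
    by rewrite !mulf_neq0 ?invr_eq0 ?mulf_neq0 // sub_f.
  apply/matrixP => i j; rewrite mxE mxval3E; have [_ _ e _] := res i j.
  by rewrite mulrAC -e mulrAC mulfV ?mul1r // !mulf_neq0 // sub_f.
- exists (p / (c * f o2 * (f o0 - f o2) * (f o1 - f o2))).
    by rewrite !mulf_neq0 ?invr_eq0 ?mulf_neq0 // sub_f.
  apply/matrixP => i j; rewrite mxE mxval3E; have [_ _ _ e] := res i j.
  by rewrite mulrAC -e mulrAC mulfV ?mul1r // !mulf_neq0 // sub_f.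
Qed.

(** * Simple zeros of the determinant and kernel lines *)

(** A root makes the rank drop, and a drop by two or more would make the root at least double by
    [dvdp_det_horner_rank]. *)
Lemma rank_simple_root (F : fieldType) (n : nat) (A : 'M[{poly F}]_n) (a : F) :
  root (\det A) a -> ~~ (('X - a%:P) ^+ 2 %| \det A) ->
  \rank (map_mx (horner_eval a) A) = n.-1.
Proof.
move=> ra nd; set A0 := map_mx _ _.
have det0 : \det A0 = 0 by rewrite det_map_mx; apply/eqP.
have : (\rank A0 < n)%N.
  rewrite ltn_neqAle rank_leq_row andbT; apply/negP => fA0.
  have : A0 \in unitmx by rewrite -row_free_unit.
  by rewrite unitmxE det0 unitr0.
have : (n - \rank A0 < 2)%N.
  rewrite ltnNge; apply: contra nd => le2.
  exact: dvdp_trans (dvdp_exp2l _ le2) (dvdp_det_horner_rank A a).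
by case: n A A0 {ra nd det0} => // n A A0; lia.
Qed.

Section KernelLine.
Variables (F : fieldType) (n : nat) (A : 'M[F]_n).
Hypothesis rA : \rank A = n.-1.
Hypothesis n_gt0 : (0 < n)%N.

Definition kerline : 'cV[F]_n := (nz_row (kermx A^T))^T.

Lemma rank_ker_tr1 : \rank (kermx A^T) = 1%N.
Proof. by rewrite mxrank_ker mxrank_tr rA; case: n n_gt0 => // m _; rewrite subSnn. Qed.

Lemma kerline_neq0 : kerline != 0.
Proof.
by rewrite trmx_eq0 nz_row_eq0 -mxrank_eq0 rank_ker_tr1.
Qed.

Lemma mul_kerline : A *m kerline = 0.
Proof.
rewrite -[A]trmxK -trmx_mul; apply: (can_inj (@trmxK _ _ _)).
by rewrite trmxK trmx0; apply/sub_kermxP; exact: nz_row_sub.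
Qed.

Lemma kermx_kerline : (kermx A^T <= kerline^T)%MS.
Proof.
rewrite trmxK -(mxrank_leqif_sup (nz_row_sub _)) rank_ker_tr1 rank_rV.
by rewrite -[nz_row _]trmxK trmx_eq0 kerline_neq0.
Qed.

End KernelLine.

(** * From partial fractions back to a cubic matrix polynomial *)

(** Entrywise, with [d] as Kronecker delta. The cubic coefficient is
    [(d - c (g0 + g1 + g2)) / (f0 f1 f2)], which the condition on the sum turns into
    [d ql / (f0 f1 f2)]. *)
Lemma partial_fractions3 (F : fieldType) (c ql f0 f1 f2 g0 g1 g2 d x : F) :
  c != 0 -> f0 != 0 -> f1 != 0 -> f2 != 0 ->
  x + f0 != 0 -> x + f1 != 0 -> x + f2 != 0 ->
  g0 + g1 + g2 = d * ((1 - ql) / c) ->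
  (1 + x / f0) * (1 + x / f1) * (1 + x / f2) *
    (d - c * x * ((x + f0)^-1 * g0 + (x + f1)^-1 * g1 + (x + f2)^-1 * g2)) =
  d + x * (d * (f0^-1 + f1^-1 + f2^-1)
        - c / (f0 * f1 * f2) * (f1 * f2 * g0 + f0 * f2 * g1 + f0 * f1 * g2))
    + x ^+ 2 * (d * ((f0 * f1)^-1 + (f0 * f2)^-1 + (f1 * f2)^-1)
        - c / (f0 * f1 * f2)
          * ((f1 + f2) * g0 + (f0 + f2) * g1 + (f0 + f1) * g2))
    + d * (ql / (f0 * f1 * f2) * x ^+ 3).
Proof.
move=> c0 f00 f10 f20 x0 x1 x2 sg.
have -> : g2 = d * ((1 - ql) / c) - g0 - g1 by rewrite -sg; ring.
by field; rewrite c0 f20 f10 f00 x2 x1 x0.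
Qed.

Lemma partial_fractions_mxval3 (F : fieldType) (n : nat) (c ql : F)
  (f : 'I_3 -> F) (Gb : 'I_3 -> 'M[F]_n) :
  c != 0 -> (forall i, f i != 0) -> \sum_i Gb i = ((1 - ql) / c)%:M ->
  exists At1 At2 : 'M[F]_n,
    forall x : F, (forall i : 'I_3, x + f i != 0) ->
      (\prod_(i < 3) (1 + x / f i)) *:
         (1%:M - (c * x) *: \sum_(i < 3) (x + f i)^-1 *: Gb i)
      = mxval3 At1 At2 (ql / \prod_(i < 3) f i) x.
Proof.
move=> c0 f0 sG.
exists (((f o0)^-1 + (f o1)^-1 + (f o2)^-1)%:M
   - (c / (f o0 * f o1 * f o2)) *:
     ((f o1 * f o2) *: Gb o0 + (f o0 * f o2) *: Gb o1 + (f o0 * f o1) *: Gb o2)).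
exists (((f o0 * f o1)^-1 + (f o0 * f o2)^-1 + (f o1 * f o2)^-1)%:M
   - (c / (f o0 * f o1 * f o2)) *:
     ((f o1 + f o2) *: Gb o0 + (f o0 + f o2) *: Gb o1 + (f o0 + f o1) *: Gb o2)).
move=> x xf; apply/matrixP => i j; rewrite mxval3E !big_ord3 !mxE /=.
have := partial_fractions3 c0 (f0 o0) (f0 o1) (f0 o2) (xf o0) (xf o1) (xf o2).
move=> /(_ ql (Gb o0 i j) (Gb o1 i j) (Gb o2 i j) (i == j)%:R) ->.
  by rewrite !mulr_natl.
move: sG; rewrite big_ord3 /= => /matrixP/(_ i j).
by rewrite !mxE => ->; rewrite mulr_natl.
Qed.

(** * The convolution of the cubic system and its determinant *)

Lemma big_ord9 (R : Type) (idx : R) (op : Monoid.law idx) (g : 'I_9 -> R) :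
  \big[op/idx]_(i < 9) g i =
  op (\big[op/idx]_(i < 3) first3 g i) (\big[op/idx]_(i < 6) g (@rshift 3 6 i)).
Proof.
rewrite (@big_split_ord _ _ _ 3 6); congr (op _ _); apply: eq_bigr => i _.
by rewrite /first3; congr (g _); apply: val_inj.
Qed.

Lemma first3_inj (T : Type) (e : 'I_9 -> T) : injective e -> injective (first3 e).
Proof. by move=> einj i j /einj/(congr1 val)/= /val_inj. Qed.

Lemma qmc3_numField (F : numFieldType) (q kappa : F) (e : 'I_9 -> F)
  (A1 A2 : 'M[F]_3) (Ar : 'I_3 -> 'M[F]_3) :
  1 - q != 0 -> kappa != 0 -> (forall i, e i != 0) -> injective e ->
  \det (mxpoly3 A1 A2 kappa) = kappa ^+ 3 *: \prod_(i < 9) ('X + (e i)%:P) ->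
  (forall x : F, x != 0 -> (forall i : 'I_3, x + first3 e i != 0) ->
     \sum_(i < 3) (x + first3 e i)^-1 *: Ar i =
     ((1 - q) * x)^-1 *:
       (1%:M - (\prod_(i < 3) (1 + x / first3 e i))^-1 *: mxval3 A1 A2 kappa x)) ->
  kappa * \prod_(i < 3) first3 e i != 1 ->
  (forall v : 'cV[F]_3, (forall i, Ar i *m v = 0) -> v = 0) ->
  let ql := (kappa * \prod_(i < 3) first3 e i)^-1 in
  let lb := (1 - ql) / (1 - q) in
  let et := fun i : 'I_9 =>
    if (i < 3)%N then e i else kappa * (\prod_(j < 3) first3 e j) * e i in
  let kt := (kappa * (\prod_(j < 3) first3 e j) ^+ 2)^-1 in
  qmc_quot_dim Ar ql lb = 3%N /\
  (forall (P : 'M[F]_(3, 3 * 3)) (Gb : 'I_3 -> 'M[F]_3),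
     \rank P = 3%N ->
     (forall v : 'cV[F]_(3 * 3),
        (P *m v == 0) = (v^T <= qmc_KL Ar ql lb)%MS) ->
     (forall i, Gb i *m P = P *m qmc_G Ar ql lb i) ->
     exists At1 At2 : 'M[F]_3,
       (forall x : F, (forall i : 'I_3, x + first3 e i != 0) ->
          (\prod_(i < 3) (1 + x / first3 e i)) *:
            (1%:M - ((1 - q) * x) *: \sum_(i < 3) (x + first3 e i)^-1 *: Gb i)
          = mxval3 At1 At2 kt x) /\
       \det (mxpoly3 At1 At2 kt) = kt ^+ 3 *: \prod_(i < 9) ('X + (et i)%:P)).
Proof.
move=> c0 k0 e0 einj detA hA mu1 capA ql lb et kt.
set f := first3 e in hA mu1 ql lb et kt *; set c := 1 - q in c0 hA lb *.
set p := \prod_(j < 3) f j in mu1 ql lb et kt *.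
have f0 i : f i != 0 by apply: e0.
have finj : injective f by apply: first3_inj.
have p0 : p != 0 by apply/prodf_neq0 => i _.
have ql0 : ql != 0 by rewrite invr_eq0 mulf_neq0.
have lb0 : lb != 0 by rewrite mulf_neq0 ?invr_eq0 // subr_eq0 eq_sym invr_eq1.
have [resA sumA] := residues_mxval3 c0 f0 finj hA.
(* Isolating one linear factor shows [- f i] as a root, simple because the other [e j] differ from
   [f i]. *)
have detX i : \det (mxpoly3 A1 A2 kappa) =
    ('X - (- f i)%:P) * (kappa ^+ 3 *:
      \prod_(j < 9 | j != widen_ord (isT : (3 <= 9)%N) i) ('X + (e j)%:P)).
  rewrite detA (bigD1 (widen_ord (isT : (3 <= 9)%N) i)) //= -scalerAr.
  by rewrite polyCN opprK.
have rankA i : \rank (Ar i) = 2%N.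
  have [s s0 ->] := resA i; rewrite mxrank_scale_nz // -map_horner_mxpoly3.
  apply: rank_simple_root; first by rewrite (detX i) rootM root_XsubC eqxx.
  rewrite (detX i) expr2 dvdp_mul2l ?polyXsubC_eq0 // dvdp_XsubCl /root hornerZ.
  rewrite mulf_neq0 ?expf_neq0 // horner_prod; apply/prodf_neq0 => j nj.
  by rewrite !hornerE addrC subr_eq0 (inj_eq einj).
have n0 i := kerline_neq0 (rankA i) isT.
have n1 i := mul_kerline (Ar i).
have n2 i := kermx_kerline (rankA i) isT.
(* Here the value of [ql] enters: [ql (1 - kappa p) / c = (ql - 1) / c = - lb]. *)
have sumB : ql *: (\sum_i Ar i) = - lb%:M.
  rewrite -[\sum_i _](scalerK c0) sumA !scale_scalar_mx -raddfN /=; congr (_%:M).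
  rewrite /lb /ql -/p; field.
  by rewrite c0 p0 k0.
split.
  by rewrite /qmc_quot_dim (rank_qmc_KL n0 n1 n2 lb0 sumB capA).
move=> P Gb rP hP GbP.
have Pfree : row_free P by rewrite /row_free rP.
have PKL (v : 'cV[F]_(3 * 3)) : (v^T <= qmc_KL Ar ql lb)%MS -> P *m v = 0.
  by rewrite -hP => /eqP.
have sumG := sum_qmc_quot n1 n2 lb0 sumB Pfree PKL GbP.
have [At1 [At2 hAt]] := partial_fractions_mxval3 c0 f0 sumG.
have ktE : kt = ql / p by rewrite /kt /ql; field; rewrite p0 k0.
rewrite -ktE in hAt; exists At1, At2; split => //.
(* The excluded points: [x = 0], the poles [x = - f i], and the points where [y = ql x] meets
   [- f i], at which the eigenvalues on K vanish. *)
pose g := 'X * \prod_i ('X + (f i)%:P) * \prod_i ('X + (f i / ql)%:P).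
have g0 : g != 0.
  rewrite !mulf_neq0 ?polyX_eq0 //; apply/prodf_neq0 => i _;
    exact: monic_neq0 (monicXaddC _).
apply: (poly_eq_cofinite g0) => x.
rewrite !hornerE !horner_prod !mulf_eq0 !negb_or -andbA => /and3P[x0].
move=> /prodf_neq0 xf' /prodf_neq0 yf'.
have xf i : x + f i != 0 by have := xf' i isT; rewrite !hornerE.
have yf i : ql * x + f i != 0.
  have := yf' i isT; rewrite !hornerE => yi.
  by rewrite -[f i](divfK ql0) [_ / ql * ql]mulrC -mulrDr mulf_neq0.
rewrite horner_det_mxpoly3 -hAt // detZ.
pose w i := c * x / (x + f i).
have dE i : 1 - lb * w i = (ql * x + f i) / (x + f i).
  by rewrite /lb /w; field; rewrite xf c0.
have d0 i : 1 - lb * w i != 0 by rewrite dE mulf_neq0 ?invr_eq0.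
have := det_qmc_quot n0 n1 n2 lb0 sumB capA Pfree PKL GbP erefl d0.
have -> : 1%:M - \sum_i w i *: Gb i =
    1%:M - (c * x) *: \sum_i (x + f i)^-1 *: Gb i.
  by rewrite scaler_sumr; congr (_ - _); apply: eq_bigr => i _; rewrite scalerA.
set D := \det (1%:M - _ *: _).
(* Since [ql * w i / (1 - lb * w i) = c y / (y + f i)] with [y = ql x], the hypothesis [hA] at [y]
   identifies this matrix with A'(y). *)
have -> : 1%:M - \sum_i (ql * w i / (1 - lb * w i)) *: Ar i =
    (\prod_i (1 + ql * x / f i))^-1 *: mxval3 A1 A2 kappa (ql * x).
  have y0 : ql * x != 0 by rewrite mulf_neq0.
  have -> : \sum_i (ql * w i / (1 - lb * w i)) *: Ar i =
     (c * (ql * x)) *: \sum_i (ql * x + f i)^-1 *: Ar i.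
    rewrite scaler_sumr; apply: eq_bigr => i _; rewrite scalerA dE; congr (_ *: _).
    by rewrite /w; field; rewrite yf xf.
  by rewrite hA // scalerA mulfV ?mulf_neq0 // scale1r subKr.
rewrite detZ -horner_det_mxpoly3 detA !hornerZ !horner_prod !big_ord9 /=.
rewrite prodrXl.
have -> : \prod_i (1 - lb * w i) = (\prod_i (ql * x + f i)) / \prod_i (x + f i).
  by rewrite -prodf_div; apply: eq_bigr => i _; rewrite dE.
have prodE y : \prod_i (1 + y / f i) = (\prod_i (y + f i)) / p.
  rewrite -prodf_div; apply: eq_bigr => i _.
  by rewrite mulrDl divff // addrC.
rewrite !prodE.
have -> : \prod_(i < 3) first3 (fun i => ('X + (e i)%:P).[ql * x]) i
    = \prod_i (ql * x + f i).
  by apply: eq_bigr => i _; rewrite /first3 !hornerE.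
have -> : \prod_(i < 3) first3 (fun i => ('X + (et i)%:P).[x]) i
    = \prod_i (x + f i).
  by apply: eq_bigr => i _; rewrite /first3 !hornerE /et /= ltn_ord.
pose Q := \prod_(i < 6) (ql * x + e (@rshift 3 6 i)).
have -> : \prod_(i < 6) ('X + (e (@rshift 3 6 i))%:P).[ql * x] = Q.
  by apply: eq_bigr => i _; rewrite !hornerE.
(* For the last six indices [et i = e i / ql], so each factor is [ql^-1 (ql x + e i)]. *)
have -> : \prod_(i < 6) ('X + (et (@rshift 3 6 i))%:P).[x] = ql ^- 6 * Q.
  have -> : ql ^- 6 = \prod_(i < 6) ql^-1 by rewrite prodr_const card_ord exprVn.
  rewrite -big_split /=.
  apply: eq_bigr => i _; rewrite !hornerE /et /=.
  by rewrite mulrDr mulKf // /ql invrK.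
have PA0 : \prod_i (x + f i) != 0 by apply/prodf_neq0 => i _.
have PB0 : \prod_i (ql * x + f i) != 0 by apply/prodf_neq0 => i _.
move: PA0 PB0; move: (\prod_i (x + f i)) (\prod_i (ql * x + f i)) => PA PB PA0 PB0.
move=> hD.
(* [hD] determines [D] times the product [PB / PA] of the eigenvalues on K, so that factor is
   inserted and divided out. *)
have -> : D = (D * (PB / PA)) * (PA / PB) by field; rewrite PA0 PB0.
by rewrite hD /kt /ql; field; rewrite p0 k0 PB0 PA0.
Qed.

Theorem mainTheorem5 (R : realType) (q kappa : complex R) (e : 'I_9 -> complex R)
  (A1 A2 : 'M[complex R]_3) (Ar : 'I_3 -> 'M[complex R]_3) :
  (* 0 < |q| < 1 *)
  0 < `|q| -> `|q| < 1 ->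
  (* kappa, e_1, ..., e_9 nonzero, e_i pairwise distinct *)
  kappa != 0 -> (forall i, e i != 0) -> injective e ->
  kappa ^+ 3 * \prod_(i < 9) e i = 1 ->
  (* det A(x) = kappa^3 prod_i (x + e_i) *)
  \det (mxpoly3 A1 A2 kappa) = kappa ^+ 3 *: \prod_(i < 9) ('X + (e i)%:P) ->
  (* A_1, A_2, A_3 : sum_i A_i/(x+e_i) = (I - A'(x)) / ((1-q) x) *)
  (forall x : complex R, x != 0 -> (forall i : 'I_3, x + first3 e i != 0) ->
     \sum_(i < 3) (x + first3 e i)^-1 *: Ar i =
     ((1 - q) * x)^-1 *:
       (1%:M - (\prod_(i < 3) (1 + x / first3 e i))^-1 *: mxval3 A1 A2 kappa x)) ->
  (* kappa e1 e2 e3 <> 1 *)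
  kappa * \prod_(i < 3) first3 e i != 1 ->
  (* Ker A_1 /\ Ker A_2 /\ Ker A_3 = {0} *)
  (forall v : 'cV[complex R]_3, (forall i, Ar i *m v = 0) -> v = 0) ->
  let ql := (kappa * \prod_(i < 3) first3 e i)^-1 in   (* q^lambda *)
  let lb := (1 - ql) / (1 - q) in                        (* [lambda] *)
  let et := fun i : 'I_9 =>
    if (i < 3)%N then e i else kappa * (\prod_(j < 3) first3 e j) * e i in
  let kt := (kappa * (\prod_(j < 3) first3 e j) ^+ 2)^-1 in
  (* the quotient C^9 / (K + L) is 3-dimensional *)
  qmc_quot_dim Ar ql lb = 3%N /\
  (* for any basis of the quotient, i.e. any surjection P : C^9 -> C^3 with
     kernel K + L, and the induced matrices Gb_i (Gb_i P = P G_i) ... *)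
  (forall (P : 'M[complex R]_(3, 3 * 3)) (Gb : 'I_3 -> 'M[complex R]_3),
     \rank P = 3%N ->
     (forall v : 'cV[complex R]_(3 * 3),
        (P *m v == 0) = (v^T <= qmc_KL Ar ql lb)%MS) ->
     (forall i, Gb i *m P = P *m qmc_G Ar ql lb i) ->
     exists At1 At2 : 'M[complex R]_3,
       (forall x : complex R, (forall i : 'I_3, x + first3 e i != 0) ->
          (\prod_(i < 3) (1 + x / first3 e i)) *:
            (1%:M - ((1 - q) * x) *: \sum_(i < 3) (x + first3 e i)^-1 *: Gb i)
          = mxval3 At1 At2 kt x) /\
       \det (mxpoly3 At1 At2 kt) = kt ^+ 3 *: \prod_(i < 9) ('X + (et i)%:P)).
Proof.
move=> _ q1 k0 e0 einj _ detA hA mu1 capA.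
apply: (qmc3_numField _ k0 e0 einj detA hA mu1 capA).
by apply/eqP => /subr0_eq q_eq1; move: q1; rewrite -q_eq1 normr1 ltxx.
Qed.
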